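(* Let $\Gamma$ be the $1$-skeleton of an extra-special triangulation of the $2$-disk such that the underlying special triangulation (the one from which the extra-special triangulation is obtained) is favourable, i.e. its $1$-skeleton is a favourable graph. Then $\Gamma\in\mathcal{G}$, where $\mathcal{G}$ is the family of finite simplicial unfavourable graphs with simply connected flag complex that have a spanning tree $T$ such that all internal triangles of the graph are favourable with respect to $T$.
   Context: A triangulation of the $2$-disk $D^2$ is special if it can be obtained from a triangle by adding one triangle at a time, along a unique boundary edge. A triangulation of $D^2$ is extra-special if it is obtained from a special triangulation (the underlying special triangulation) by adding one triangle along each boundary edge. All graphs are finite and simplicial (no loops, no multiple edges). The flag complex $\triangle_\Gamma$ of a graph $\Gamma$ is the simplicial complex with vertex set $V(\Gamma)$ whose $(k-1)$-simplices are the $k$-cliques of $\Gamma$. A spanning tree of $\Gamma$ is a subgraph that is a tree and contains every vertex of $\Gamma$. A triangle of $\Gamma$ is a $3$-clique, regarded as a subgraph with three vertices and three edges. Edge-set complement: let $\Gamma$ be a connected graph and $\triangle$ a triangle of $\Gamma$. Let $\Gamma'$ be the graph with $V(\Gamma')=V(\Gamma)$ and $E(\Gamma')=E(\Gamma)\setminus E(\triangle)$, and let $S$ be the set of isolated vertices of $\Gamma'$. The edge-set complement $\triangle_\Gamma^c$ is the induced subgraph of $\Gamma$ on $V(\Gamma)\setminus S$. Internal triangles: a triangle $\triangle$ of $\Gamma$ is internal if its intersection (as subgraphs) with $\triangle_\Gamma^c$ is neither one vertex nor one edge (with its two endpoints). A triangle is strictly internal if it is contained in an induced complete graph $K_n$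 with $n\ge 4$. Favourable triangles: given a spanning tree $T$ of $\Gamma$, a triangle $\triangle$ is favourable with respect to $T$ if either it has exactly $2$ edges in $E(T)$ or it is strictly internal; otherwise it is unfavourable with respect to $T$. Favourable graphs: a graph $\Gamma$ with simply connected flag complex is favourable if there is a spanning tree $T$ such that every triangle of $\Gamma$ is favourable with respect to $T$; it is unfavourable if for every spanning tree $T$ there is at least one triangle that is unfavourable with respect to $T$. *)

(* Defs.v *)
From mathcomp Require Import all_boot all_order all_algebra.

Set Implicit Arguments.
Unset Strict Implicit.
Unset Printing Implicit Defensive.

Local Open Scope set_scope.

(* Vertex sets are subsets of an ambient finite type T, so that a graph, its
   subgraphs and its induced subgraphs all have the same type; T may contain
   points that are vertices of none of them. *)
Record graph (T : finType) := Graph {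
  verts : {set T};
  edges : {set {set T}};
  edges_wf : forall e, e \in edges -> (e \subset verts) && (#|e| == 2)
}.

Section Graphs.
Variable T : finType.
Implicit Types (G H : graph T) (A B : {set T}).

Definition adj G : rel T := [rel u v | [set u; v] \in edges G].

Definition subgraph H G : bool :=
  (verts H \subset verts G) && (edges H \subset edges G).

Fact induced_subgraph_wf G A e :
  e \in [set e in edges G | e \subset A] ->
  (e \subset verts G :&: A) && (#|e| == 2).
Proof.
by rewrite inE => /andP[/edges_wf/andP[eV ->] eA]; rewrite subsetI eV eA.
Qed.
Definition induced_subgraph G A : graph T := Graph (@induced_subgraph_wf G A).

Fact remove_edges_wf G (F : {set {set T}}) e :
  e \in edges G :\: F -> (e \subset verts G) && (#|e| == 2).
Proof. by rewrite inE => /andP[_ /edges_wf]. Qed.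
Definition remove_edges G (F : {set {set T}}) : graph T :=
  Graph (@remove_edges_wf G F).

Fact inter_graph_wf G H e :
  e \in edges G :&: edges H ->
  (e \subset verts G :&: verts H) && (#|e| == 2).
Proof.
rewrite inE => /andP[/edges_wf/andP[eG ->] /edges_wf/andP[eH _]].
by rewrite subsetI eG eH.
Qed.
Definition inter_graph G H : graph T := Graph (@inter_graph_wf G H).

Fact complete_on_wf A (e : {set T}) :
  e \in [set e : {set T} | (e \subset A) && (#|e| == 2)] ->
  (e \subset A) && (#|e| == 2).
Proof. by rewrite inE. Qed.
Definition complete_on A : graph T := Graph (@complete_on_wf A).

Definition clique G A : bool :=
  (A \subset verts G) && [forall u in A, forall v in A, (u != v) ==> adj G u v].

(* A triangle is represented by its set of vertices; complete_on A is the
   triangle as a subgraph. *)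
Definition triangle G A : bool := clique G A && (#|A| == 3).

Definition connected_graph G : Prop :=
  verts G != set0 /\
  forall u v, u \in verts G -> v \in verts G -> connect (adj G) u v.

(* An edge traversed back and forth is a duplicate-free cyclic sequence of
   size 2, hence the bound. *)
Definition acyclic_graph G : Prop :=
  forall c : seq T, ucycle (adj G) c -> size c <= 2.

Definition tree G : Prop := connected_graph G /\ acyclic_graph G.

Definition spanning_tree G H : Prop :=
  [/\ subgraph H G, tree H & verts H = verts G].

Definition isolated_verts G : {set T} :=
  [set v in verts G | [forall e in edges G, v \notin e]].

Definition edge_set_complement G A : graph T :=
  induced_subgraph G
    (verts G :\: isolated_verts (remove_edges G (edges (complete_on A)))).

Definition is_one_vertex G : bool := #|verts G| == 1.
Definition is_one_edge G : bool := (#|verts G| == 2) && (#|edges G| == 1).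

Definition internal G A : bool :=
  let I := inter_graph (complete_on A) (edge_set_complement G A) in
  [&& triangle G A, ~~ is_one_vertex I & ~~ is_one_edge I].

Definition strictly_internal G A : bool :=
  triangle G A && [exists B : {set T}, [&& clique G B, 4 <= #|B| & A \subset B]].

Definition favourable_triangle G H A : bool :=
  (#|edges (complete_on A) :&: edges H| == 2) || strictly_internal G A.

End Graphs.

(* Abstract simplicial complexes; the empty set is not a face. *)
Record complex (T : finType) := Complex {
  faces : {set {set T}};
  faces_neq0 : forall A, A \in faces -> A != set0;
  faces_sub : forall A B : {set T}, A \in faces -> B \subset A -> B != set0 -> B \in faces
}.

Section Complexes.
Variable T : finType.
Implicit Types (K L : complex T) (G : graph T) (A e : {set T}).

Definition simplex A : {set {set T}} := [set B : {set T} | (B \subset A) && (B != set0)].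

Definition vertices K : {set T} := [set v | [set v] \in faces K].

Fact one_skeleton_wf K e :
  e \in [set e in faces K | #|e| == 2] -> (e \subset vertices K) && (#|e| == 2).
Proof.
rewrite inE => /andP[eK ->]; rewrite andbT; apply/subsetP => v ve.
rewrite inE (faces_sub eK) ?sub1set //.
by apply/set0Pn; exists v; rewrite inE.
Qed.
Definition one_skeleton K : graph T := Graph (@one_skeleton_wf K).

Fact flag_neq0 G A :
  A \in [set A : {set T} | (A != set0) && clique G A] -> A != set0.
Proof. by rewrite inE => /andP[]. Qed.
Fact flag_sub G A (B : {set T}) :
  A \in [set A : {set T} | (A != set0) && clique G A] -> B \subset A ->
  B != set0 -> B \in [set A : {set T} | (A != set0) && clique G A].
Proof.
rewrite !inE => /andP[_ /andP[AV /forall_inP cA]] BA -> /=.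
rewrite /clique (subset_trans BA AV); apply/forall_inP => u uB.
apply/forall_inP => v vB.
by have /forall_inP := cA u (subsetP BA u uB); apply; apply: (subsetP BA).
Qed.
Definition flag_complex G : complex T :=
  Complex (@flag_neq0 G) (@flag_sub G).

Definition boundary_edge K e : bool :=
  [&& e \in faces K, #|e| == 2 &
      #|[set A in faces K | (#|A| == 3) && (e \subset A)]| == 1].

(* A triangle glued along exactly one edge e has its third vertex outside the
   complex it is glued to. *)
Inductive built_from_triangle : complex T -> Prop :=
| built_triangle K A :
    #|A| = 3 -> faces K = simplex A -> built_from_triangle K
| built_add K L e v :
    built_from_triangle L -> boundary_edge L e -> v \notin vertices L ->
    faces K = faces L :|: simplex (v |: e) -> built_from_triangle K.

(* apex e is the third vertex of the triangle glued along the boundary edge e;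
   its values elsewhere are irrelevant. *)
Definition adds_triangle_along_boundary L K : Prop :=
  exists apex : {set T} -> T,
  [/\ forall e, boundary_edge L e -> apex e \notin vertices L,
      {in boundary_edge L &, injective apex} &
      faces K =
        faces L :|: \bigcup_(e | boundary_edge L e) simplex (apex e |: e)].

End Complexes.

From mathcomp Require Import all_classical all_reals all_analysis.
Import Order.TTheory GRing.Theory Num.Theory.
Import numFieldNormedType.Exports.

Local Open Scope classical_set_scope.
Local Open Scope ring_scope.

Section Topology.
Variable R : realType.

Definition homeomorphic (X Y : topologicalType) (A : set X) (B : set Y) : Prop :=
  exists (f : X -> Y) (g : Y -> X),
  [/\ {within A, continuous f}, {within B, continuous g},
      f @` A `<=` B, g @` B `<=` A &
      {in A, cancel f g} /\ {in B, cancel g f}].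

Definition path_connected (X : topologicalType) (A : set X) : Prop :=
  A !=set0 /\
  forall x y, A x -> A y ->
  exists p : R -> X,
  [/\ {within `[0, 1], continuous p}, p @` `[0, 1] `<=` A, p 0 = x & p 1 = y].

Definition loop (X : topologicalType) (A : set X) (x : X) (p : R -> X) : Prop :=
  [/\ {within `[0, 1], continuous p}, p @` `[0, 1] `<=` A, p 0 = x & p 1 = x].

Definition null_homotopic (X : topologicalType) (A : set X) (x : X)
    (p : R -> X) : Prop :=
  exists h : R * R -> X,
  [/\ {within `[0, 1] `*` `[0, 1], continuous h},
      h @` (`[0, 1] `*` `[0, 1]) `<=` A,
      {in `[0, 1], forall t, h (0, t) = p t},
      {in `[0, 1], forall t, h (1, t) = x} &
      {in `[0, 1], forall s, h (s, 0) = x /\ h (s, 1) = x}].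

Definition simply_connected (X : topologicalType) (A : set X) : Prop :=
  path_connected A /\
  forall x p, A x -> loop A x p -> null_homotopic A x p.

Definition unit_disk : set (R * R)%type :=
  [set p | p.1 ^+ 2 + p.2 ^+ 2 <= 1].

Section Finite.
Variable T : finType.
Implicit Types (G : graph T) (K L : complex T).

(* Geometric realization, by barycentric coordinates. *)
Definition realization K : set {ptws T -> R} :=
  [set x : {ptws T -> R} | [/\ forall v, 0 <= x v, \sum_v x v = 1 &
    [set v | x v != 0]%SET \in faces K]].

Definition simply_connected_flag G : Prop :=
  simply_connected (realization (flag_complex G)).

Definition favourable G : Prop :=
  simply_connected_flag G /\
  exists2 H, spanning_tree G H &
    forall A, triangle G A -> favourable_triangle G H A.

Definition unfavourable G : Prop :=
  simply_connected_flag G /\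
  forall H, spanning_tree G H ->
    exists2 A, triangle G A & ~~ favourable_triangle G H A.

Definition familyG G : Prop :=
  [/\ unfavourable G, simply_connected_flag G &
      exists2 H, spanning_tree G H &
        forall A, internal G A -> favourable_triangle G H A].

Definition disk_triangulation K : Prop :=
  homeomorphic (realization K) unit_disk.

Definition special K : Prop :=
  disk_triangulation K /\ built_from_triangle K.

Definition extra_special_from L K : Prop :=
  [/\ special L, disk_triangulation K & adds_triangle_along_boundary L K].

End Finite.
End Topology.

(* Main.v *)
Require Import Defs.
From mathcomp Require Import all_boot.

(** Write G for the 1-skeleton of K.  A triangulation built by gluing triangles
    along boundary edges is pure of dimension 2, and it is a flag complex: a
    clique that uses the third vertex of a glued triangle lies in that triangle,
    because this vertex is joined to nothing else ([clique_cone]).  Both K and L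
    are of this kind, so their 1-skeleta contain no 4-clique, no triangle is
    strictly internal, and a triangle is favourable exactly when two of its
    edges are in the tree ([favourable_triangle_flag]).

    - Simple connectedness: the flag complex of G is K itself, whose realization
      is homeomorphic to the disk, where straight-line homotopies contract every
      loop ([homeomorphic_disk_simply_connected]).

    - G is unfavourable: suppose that every triangle of K has exactly two edges
      in a spanning tree.  A triangle of L then has an edge e outside the tree.
      Every edge of L is in at least two triangles of K, since those that are
      in only one triangle of L have received another one
      ([old_edge_in_two_triangles]).  The other two edges of each of two
      triangles containing e are in the tree, and together they form a
      4-cycle: a contradiction ([acyclic_shared_edge]).

    - Favourable internal triangles: given a tree for which all the triangles of
      L are favourable, attach each new vertex to it by a single edge
      ([pendant_tree]).  The triangles of L keep their tree edges, and the
      triangles added last are not internal: removing the edges of such a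
      triangle isolates its new vertex only, so that its edge-set complement
      meets it in one edge ([apex_triangle_not_internal]). *)

Set Implicit Arguments.
Unset Strict Implicit.
Unset Printing Implicit Defensive.

Local Open Scope set_scope.

(** * Trees and triangles *)

Section Graphs.
Variable T : finType.
Implicit Types (G H : graph T) (A B : {set T}).

Lemma adj_sym G : symmetric (adj G).
Proof. by move=> u v; rewrite /adj /= finset.setUC. Qed.

Lemma adj_verts G u v :
  adj G u v -> [/\ u \in verts G, v \in verts G & u != v].
Proof.
move=> /edges_wf /andP[/subsetP sV]; rewrite cards2 => /eqP c2.
by rewrite !sV ?set21 ?set22 //; split=> //; case: eqP c2.
Qed.

Section TwoTreeEdges.
Variables (H : graph T) (A : {set T}).
Hypotheses (A3 : #|A| = 3)
  (H2 : #|edges (complete_on A) :&: edges H| = 2).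

Let card_edges : #|edges (complete_on A)| = 3.
Proof. by rewrite /= cards_draws A3. Qed.

Lemma missing_edge :
  exists f : {set T}, [/\ f \subset A, #|f| = 2 & f \notin edges H].
Proof.
have : ~~ (edges (complete_on A) \subset edges H).
  by apply/negP=> /setIidPl E; move: H2; rewrite E card_edges.
by case/subsetPn=> f; rewrite inE => /andP[fA /eqP f2] fH; exists f.
Qed.

Lemma other_edges (f g : {set T}) :
  f \subset A -> #|f| = 2 -> f \notin edges H ->
  g \subset A -> #|g| = 2 -> g != f -> g \in edges H.
Proof.
move=> fA f2 fH gA g2 gf.
have fE : f \in edges (complete_on A) by rewrite inE fA f2.
have sub : edges (complete_on A) :&: edges H \subset edges (complete_on A) :\ f.
  apply/subsetP=> h; rewrite in_setI in_setD1 => /andP[-> hH]; rewrite andbT.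
  by apply: contraNneq fH => <-.
have /eqP E : edges (complete_on A) :&: edges H == edges (complete_on A) :\ f.
  have := cardsD1 f (edges (complete_on A)).
  by rewrite eqEcard sub H2 fE card_edges add1n => -[<-].
have : g \in edges (complete_on A) :\ f by rewrite in_setD1 gf inE gA g2.
by rewrite -E => /setIP[].
Qed.

End TwoTreeEdges.

(** If A = {x, y, z} and B = {x, y, w} share the non-tree edge f = {x, y}, then
    x, z, y, w is a cycle of the tree unless z = w. *)
Lemma acyclic_shared_edge H A B (f : {set T}) :
  acyclic_graph H -> #|A| = 3 -> #|B| = 3 -> #|f| = 2 ->
  f \subset A -> f \subset B -> f \notin edges H ->
  #|edges (complete_on A) :&: edges H| = 2 ->
  #|edges (complete_on B) :&: edges H| = 2 -> A = B.
Proof.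
move=> acyc A3 B3 f2 fA fB fH HA HB; apply/eqP; apply: contraT => AB.
have /eqP/cards2P[x [y [xy fE]]] := f2.
have third (C : {set T}) : f \subset C -> #|C| = 3 ->
    exists2 z, z \notin f & C = z |: f.
  move=> fC C3; have /set0Pn[z /setDP[zC zf]] : C :\: f != set0.
    by rewrite -card_gt0 cardsD (setIidPr fC) C3 f2.
  exists z => //; apply/esym/eqP.
  by rewrite eqEcard subUset sub1set zC fC cardsU1 zf f2 C3.
have [z zf AE] := third A fA A3; have [w wf BE] := third B fB B3.
have zw : z != w by apply: contraNneq AB => zw; rewrite AE BE zw.
have in_tree (C : {set T}) u v : f \subset C -> #|C| = 3 ->
    #|edges (complete_on C) :&: edges H| = 2 ->
    u \in C -> u \notin f -> v \in f -> adj H u v.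
  move=> fC C3 HC uC uf vf.
  have uv : u != v by apply: contraNneq uf => ->.
  apply: (other_edges C3 HC fC f2 fH).
  - by rewrite subUset !sub1set uC (subsetP fC).
  - by rewrite cards2 uv.
  - by apply: contraNneq uf => <-; rewrite set21.
have xf : x \in f by rewrite fE set21.
have yf : y \in f by rewrite fE set22.
have zA : z \in A by rewrite AE setU11.
have wB : w \in B by rewrite BE setU11.
suff /acyc : ucycle (adj H) [:: x; z; y; w] by [].
have zx := in_tree A z x fA A3 HA zA zf xf.
have zy := in_tree A z y fA A3 HA zA zf yf.
have wx := in_tree B w x fB B3 HB wB wf xf.
have wy := in_tree B w y fB B3 HB wB wf yf.
have uniq4 : uniq [:: x; z; y; w].
  move: zf wf; rewrite fE !inE !negb_or => /andP[nzx nzy] /andP[nwx nwy].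
  by rewrite /= !inE !negb_or xy zw nzy (eq_sym x z) nzx (eq_sym x w) nwx
             (eq_sym y w) nwy.
by rewrite /ucycle uniq4 /= (adj_sym H x z) zx zy (adj_sym H y w) wy wx.
Qed.

(** * Attaching pendant vertices to a tree *)

Section Pendant.
Variables (G : graph T) (U : {set T}) (r : T -> T).
Hypothesis Ur : forall u, u \in U -> (u \notin verts G) && (r u \in verts G).

Fact pendant_wf (e : {set T}) :
  e \in edges G :|: [set [set u; r u] | u in U] ->
  (e \subset verts G :|: U) && (#|e| == 2).
Proof.
case/setUP=> [/edges_wf/andP[eV ->]|/imsetP[u uU ->]].
  by rewrite (subset_trans eV) ?subsetUl.
have /andP[uV ruV] := Ur uU.
rewrite subUset !sub1set !inE uU ruV orbT /= cards2.
by have -> : u != r u by apply: contraNneq uV => ->.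
Qed.

Definition pendant : graph T := Graph pendant_wf.

Lemma adj_pendant_old u v :
  u \in verts G -> v \in verts G -> adj pendant u v = adj G u v.
Proof.
move=> uV vV; rewrite /adj /= inE; case: (_ \in edges G) => //=.
apply/imsetP=> -[w wU E]; have /andP[/negP[]] := Ur wU.
have : w \in [set u; v] by rewrite E set21.
by case/set2P=> ->.
Qed.

Lemma adj_pendant_new u v : u \in U -> adj pendant u v -> v = r u.
Proof.
move=> uU uv; have /andP[uV ruV] := Ur uU; have [_ _ neq] := adj_verts uv.
move: uv; rewrite /adj /= inE => /orP[/edges_wf/andP[]|].
  by rewrite subUset sub1set (negPf uV).
case/imsetP=> w wU E; have /andP[wV rwV] := Ur wU.
have : u \in [set w; r w] by rewrite -E set21.
case/set2P=> [uw|urw]; last by rewrite urw rwV in uV.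
have : v \in [set w; r w] by rewrite -E set22.
by rewrite -uw in_set2 eq_sym (negPf neq) => /eqP.
Qed.

Lemma pendant_connected : connected_graph G -> connected_graph pendant.
Proof.
case=> /set0Pn[x0 x0V] con; split.
  by apply/set0Pn; exists x0; rewrite inE x0V.
have sub : subrel (connect (adj G)) (connect (adj pendant)).
  apply: connect_sub => u v uv; apply: connect1.
  by have [uV vV _] := adj_verts uv; rewrite adj_pendant_old.
have conx0 u : u \in verts pendant -> connect (adj pendant) u x0.
  case/setUP=> [uV|uU]; first exact/sub/con.
  have /andP[_ ruV] := Ur uU.
  apply: connect_trans (sub _ _ (con _ _ ruV x0V)); apply: connect1.
  by rewrite /adj /= inE; apply/orP; right; apply/imsetP; exists u.
move=> u v uV vV; apply: connect_trans (conx0 u uV) _.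
by rewrite (sym_connect_sym (@adj_sym _)); apply: conx0.
Qed.

(** In a cycle through a new vertex u, both cyclic neighbours of u are r u; they
    coincide, so the cycle has size 2.  A cycle through no new vertex is already
    a cycle of G. *)
Lemma pendant_acyclic : acyclic_graph G -> acyclic_graph pendant.
Proof.
move=> acyc c /andP[cyc unq].
have [/hasP[u uc uU]|/hasPn noU] := boolP (has (mem U) c).
  have [i s rotE] := rot_to uc.
  rewrite -(rot_cycle i) rotE in cyc; rewrite -(rot_uniq i) rotE in unq.
  rewrite -(size_rot i) rotE.
  case: s {rotE} cyc unq => [|x s] //= /andP[ux xs] /and3P[_ xNs _].
  move: xs; rewrite rcons_path => /andP[_]; rewrite adj_sym.
  move=> /(adj_pendant_new uU); rewrite -(adj_pendant_new uU ux).
  by case: s xNs => //= y s xNs xE; rewrite -{1}xE mem_last in xNs.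
apply: acyc; rewrite /ucycle unq andbT.
have cV : {in c, forall v, v \in verts G}.
  move=> v vc; have [vV _ _] := adj_verts (next_cycle cyc vc).
  by case/setUP: vV => // vU; move: (noU v vc); rewrite inE vU.
apply: (sub_in_cycle (P := mem (verts G))) cyc; last exact/allP.
by move=> u v uV vV; rewrite adj_pendant_old.
Qed.

Lemma pendant_tree : tree G -> tree pendant.
Proof. by case=> /pendant_connected con /pendant_acyclic. Qed.

End Pendant.
End Graphs.

(** * Flag complexes of pure dimension 2 *)

Section Complexes.
Variable T : finType.
Implicit Types (K L : complex T) (A B e f : {set T}).

Definition pure2 K : Prop :=
  forall A, A \in faces K ->
    exists B, [/\ B \in faces K, A \subset B & #|B| = 3].

Definition flag K : Prop :=
  forall A, A != set0 -> clique (one_skeleton K) A -> A \in faces K.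

Lemma mem_vertices K A v : A \in faces K -> v \in A -> v \in vertices K.
Proof.
move=> AK vA; rewrite inE (faces_sub AK) ?sub1set //.
by apply/set0Pn; exists v; rewrite set11.
Qed.

Lemma mem_edges K e :
  (e \in edges (one_skeleton K)) = (e \in faces K) && (#|e| == 2).
Proof. by rewrite inE. Qed.

Lemma face_clique K A : A \in faces K -> clique (one_skeleton K) A.
Proof.
move=> AK; apply/andP; split; first by apply/subsetP=> v; apply: mem_vertices.
apply/forall_inP=> u uA; apply/forall_inP=> v vA; apply/implyP=> uv.
rewrite /adj /= inE cards2 uv eqxx andbT (faces_sub AK) //.
  by rewrite subUset !sub1set uA.
by apply/set0Pn; exists u; rewrite set21.
Qed.

Lemma clique_flag K A : flag K -> A != set0 ->
  clique (one_skeleton K) A = (A \in faces K).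
Proof.
by move=> flagK A0; apply/idP/idP; [apply: flagK | apply: face_clique].
Qed.

Lemma faces_flag_complex K :
  flag K -> faces (flag_complex (one_skeleton K)) = faces K.
Proof.
move=> flagK; apply/setP=> A; rewrite inE.
have [->|A0] := eqVneq A set0; last by rewrite clique_flag.
by apply/esym/negP => /faces_neq0; rewrite eqxx.
Qed.

Lemma triangleE K A :
  flag K -> triangle (one_skeleton K) A = (A \in faces K) && (#|A| == 3).
Proof.
rewrite /triangle => flagK; have [A3|] := eqVneq #|A| 3; last by rewrite !andbF.
by rewrite clique_flag // -card_gt0 A3.
Qed.

(** A 4-clique would be a face, but every face is in one with 3 vertices. *)
Lemma not_strictly_internal K A :
  flag K -> pure2 K -> ~~ strictly_internal (one_skeleton K) A.
Proof.
move=> flagK pureK; apply/negP=> /andP[_ /existsP[B /and3P[clB B4 _]]].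
have BK : B \in faces K by rewrite -clique_flag // -card_gt0 (leq_trans _ B4).
have [C [_ BC C3]] := pureK B BK.
by have := leq_trans B4 (subset_leq_card BC); rewrite C3.
Qed.

Lemma favourable_triangle_flag K H A : flag K -> pure2 K ->
  favourable_triangle (one_skeleton K) H A =
  (#|edges (complete_on A) :&: edges H| == 2).
Proof.
move=> fK pK; rewrite /favourable_triangle.
by rewrite (negPf (not_strictly_internal A fK pK)) orbF.
Qed.

(** * Gluing triangles along edges *)

(** The complex K is L with a triangle glued along each edge selected by P.
    This covers both a single gluing step, where P selects one edge, and the
    passage to an extra-special triangulation, where P selects the boundary. *)
Section Cones.
Variables (L K : complex T) (P : pred {set T}) (apex : {set T} -> T).
Hypotheses (P_edge : forall e, P e -> e \in faces L /\ #|e| = 2)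
  (P_apex : forall e, P e -> apex e \notin vertices L)
  (apex_inj : {in P &, injective apex})
  (facesK : faces K = faces L :|: \bigcup_(e | P e) simplex (apex e |: e)).

Lemma cone_facesP A : reflect
  (A \in faces L \/ exists2 e, P e & (A \subset apex e |: e) && (A != set0))
  (A \in faces K).
Proof.
rewrite facesK; apply: (iffP setUP) => -[AL|Ae]; try by left.
  by right; case/bigcupP: Ae => e Pe; rewrite inE; exists e.
by right; case: Ae => e Pe Ae; apply/bigcupP; exists e; rewrite ?inE.
Qed.

Lemma sub_faces_cone A : A \in faces L -> A \in faces K.
Proof. by move=> AL; apply/cone_facesP; left. Qed.

Lemma sub_vertices_cone v : v \in vertices L -> v \in vertices K.
Proof. by rewrite !inE => /sub_faces_cone. Qed.

Lemma apex_notin e : P e -> apex e \notin e.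
Proof.
move=> Pe; apply: contra (P_apex Pe); apply: mem_vertices.
by have [] := P_edge Pe.
Qed.

Lemma cone_face e : P e -> apex e |: e \in faces K.
Proof.
move=> Pe; apply/cone_facesP; right; exists e => //; rewrite subxx.
by apply/set0Pn; exists (apex e); rewrite setU11.
Qed.

Lemma card_cone e : P e -> #|apex e |: e| = 3.
Proof.
by move=> Pe; rewrite cardsU1 apex_notin //; have [_ ->] := P_edge Pe.
Qed.

Lemma cone_face_old A : A \in faces K -> A \subset vertices L -> A \in faces L.
Proof.
case/cone_facesP=> // -[e Pe /andP[Ae A0]] AV; have [eL _] := P_edge Pe.
apply: faces_sub eL _ A0; apply/subsetP=> v vA.
have /setU1P[va|//] := subsetP Ae v vA.
by have := P_apex Pe; rewrite -va (subsetP AV).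
Qed.

(** Since apexes are pairwise distinct and new, the only faces at the apex of e
    are those of the triangle glued along e. *)
Lemma cone_face_apex e A : P e -> A \in faces K -> apex e \in A ->
  A \subset apex e |: e.
Proof.
move=> Pe AK aA; have aV := P_apex Pe.
case/cone_facesP: AK => [AL|[e' Pe' /andP[Ae' _]]].
  by rewrite (mem_vertices AL aA) in aV.
have /setU1P[/(apex_inj Pe Pe')->//|ae'] := subsetP Ae' _ aA.
by have [e'L _] := P_edge Pe'; rewrite (mem_vertices e'L ae') in aV.
Qed.

Lemma cone_new_vertex v : v \in vertices K -> v \notin vertices L ->
  exists2 e, P e & v = apex e.
Proof.
move=> vK vL; have : [set v] \in faces K by rewrite inE in vK.
case/cone_facesP=> [sL|[e Pe /andP[]]].
  by rewrite (mem_vertices sL (set11 v)) in vL.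
rewrite sub1set => /setU1P[va|ve] _; first by exists e.
by have [eL _] := P_edge Pe; rewrite (mem_vertices eL ve) in vL.
Qed.

Lemma clique_cone A : clique (one_skeleton K) A ->
  clique (one_skeleton L) A \/ exists2 e, P e & A \subset apex e |: e.
Proof.
case/andP=> /subsetP AV /forall_inP cA.
have adjA u v : u \in A -> v \in A -> u != v -> [set u; v] \in faces K.
  move=> uA vA uv; have /forall_inP/(_ v vA) := cA u uA.
  by rewrite uv /adj /= inE => /andP[].
have [AL|/subsetPn[x xA xL]] := boolP (A \subset vertices L); [left|right].
  apply/andP; split=> //; apply/forall_inP=> u uA; apply/forall_inP=> v vA.
  apply/implyP=> uv; rewrite /adj /= inE cards2 uv eqxx andbT.
  by rewrite cone_face_old ?adjA // subUset !sub1set !(subsetP AL).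
have [e Pe xa] := cone_new_vertex (AV x xA) xL.
exists e => //; apply/subsetP=> y yA; have [->|xy] := eqVneq y x.
  by rewrite xa setU11.
have /(cone_face_apex Pe) sub := adjA y x yA xA xy.
by apply: (subsetP (sub _)); rewrite -?xa ?set21 ?set22.
Qed.

Lemma flag_cone : flag L -> flag K.
Proof.
move=> flagL A A0 /clique_cone[clA|[e Pe Ae]].
  exact/sub_faces_cone/flagL.
exact: faces_sub (cone_face Pe) Ae A0.
Qed.

Lemma pure2_cone : pure2 L -> pure2 K.
Proof.
move=> pureL A /cone_facesP[/pureL[B [BL AB B3]]|[e Pe /andP[Ae _]]].
  by exists B; rewrite sub_faces_cone.
by exists (apex e |: e); rewrite cone_face // card_cone.
Qed.

(** Let S be the set of vertices isolated by the removal of the edges of A.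
    The apex is in S because all its edges are in A.  An endpoint x of e is not
    in S: by purity e is in a triangle of L, whose third vertex is outside A and
    adjacent to x.  Hence A meets its edge-set complement in the edge e. *)
Lemma apex_triangle_not_internal e : pure2 L -> P e ->
  ~~ internal (one_skeleton K) (apex e |: e).
Proof.
move=> pureL Pe; have [eL e2] := P_edge Pe.
set a := apex e; set A := a |: e.
have AK : A \in faces K := cone_face Pe.
have AV : A \subset verts (one_skeleton K).
  by apply/subsetP=> v; apply: mem_vertices.
set E := remove_edges (one_skeleton K) (edges (complete_on A)).
set S := isolated_verts E.
have aS : a \in S.
  rewrite inE /= (subsetP AV) ?setU11 //=; apply/forall_inP=> f.
  rewrite in_setD mem_edges => /andP[fA /andP[fK f2]].
  apply: contra fA => af; rewrite inE f2 andbT.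
  exact: cone_face_apex.
have eS x : x \in e -> x \notin S.
  move=> xe; rewrite inE negb_and; apply/orP; right.
  have [B [BL eB B3]] := pureL e eL.
  have /set0Pn[z /setDP[zB ze]] : B :\: e != set0.
    by rewrite -card_gt0 cardsD (setIidPr eB) B3 e2.
  have zA : z \notin A.
    rewrite !inE negb_or ze andbT.
    by apply: contraNneq (P_apex Pe) => za; rewrite -/a -za (mem_vertices BL).
  have xz : x != z by apply: contraNneq ze => <-.
  apply/forall_inPn; exists [set x; z]; last by rewrite negbK set21.
  rewrite in_setD mem_edges cards2 xz eqxx andbT; apply/andP; split.
    by apply: contra zA; rewrite inE subUset !sub1set => /andP[/andP[]].
  apply/sub_faces_cone/(faces_sub BL).
    by rewrite subUset !sub1set zB (subsetP eB).
  by apply/set0Pn; exists x; rewrite set21.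
have AS : A :\: S = e.
  apply/setP=> x; rewrite in_setD in_setU1; have [->|xa] /= := eqVneq x a.
    by rewrite aS; apply/esym/negbTE/apex_notin.
  by have [/eS->//|] := boolP (x \in e); rewrite ?andbF.
apply/negP=> /and3P[_ _ /negP]; apply; apply/andP; split.
  rewrite [verts _]/=.
  suff -> : A :&: (vertices K :&: (vertices K :\: S)) = e by rewrite e2.
  rewrite -[in RHS]AS; apply/setP=> x; rewrite !in_setI !in_setD.
  have [xA|] /= := boolP (x \in A); last by rewrite andbF.
  by have /= -> := subsetP AV x xA; rewrite andbT.
suff -> : edges (inter_graph (complete_on A)
    (edge_set_complement (one_skeleton K) A)) = [set e] by rewrite cards1.
apply/setP=> f; rewrite in_setI in_set1 [edges (complete_on A)]/= inE.
apply/idP/eqP=> [/andP[/andP[fA f2]]|->].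
  rewrite inE => /andP[_]; rewrite subsetD => /andP[_ fS].
  by apply/eqP; rewrite eqEcard e2 (eqP f2) leqnn andbT -AS subsetD fA.
rewrite e2 eqxx andbT inE mem_edges sub_faces_cone // e2 eqxx /= subsetUr /=.
apply/subsetP=> x xe; rewrite in_setD eS //=.
exact/sub_vertices_cone/(mem_vertices eL).
Qed.

End Cones.

Lemma built_flag_pure L : built_from_triangle L ->
  [/\ flag L, pure2 L & exists2 A, A \in faces L & #|A| = 3].
Proof.
elim=> {L} [K A A3 facesK|K L e v _ [flagL pureL [A AL A3]] /and3P[eL /eqP e2 _]
  vL facesK].
  have A0 : A != set0 by rewrite -card_gt0 A3.
  have AK : A \in faces K by rewrite facesK inE subxx.
  split; last by exists A.
    move=> B B0 /andP[/subsetP BV _]; rewrite facesK inE B0 andbT.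
    apply/subsetP=> x /BV; rewrite inE facesK inE sub1set.
    by case/andP.
  by move=> B; rewrite facesK inE => /andP[BA _]; exists A; rewrite -facesK.
(* One step glues a triangle along the single edge e. *)
have P_edge f : f == e -> f \in faces L /\ #|f| = 2 by move=> /eqP->.
have P_apex f : f == e -> v \notin vertices L by [].
have inj : {in pred1 e &, injective (fun=> v)} by move=> f g /eqP-> /eqP->.
have fK : faces K = faces L :|: \bigcup_(f | f == e) simplex (v |: f).
  by rewrite big_pred1_eq.
split.
- exact: (flag_cone P_edge P_apex inj fK).
- exact: (pure2_cone P_edge P_apex fK).
- by exists A => //; apply: sub_faces_cone fK _ AL.
Qed.

(** * Gluing a triangle along each boundary edge *)

Section ExtraSpecial.
Variables (L K : complex T) (apex : {set T} -> T).
Hypotheses (flagL : flag L) (pureL : pure2 L)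
  (triL : exists2 A, A \in faces L & #|A| = 3)
  (apexN : forall e, boundary_edge L e -> apex e \notin vertices L)
  (apex_inj : {in boundary_edge L &, injective apex})
  (facesK : faces K =
    faces L :|: \bigcup_(e | boundary_edge L e) simplex (apex e |: e)).

Let P_edge e : boundary_edge L e -> e \in faces L /\ #|e| = 2.
Proof. by case/and3P=> eL /eqP. Qed.
Let flagK : flag K := flag_cone P_edge apexN apex_inj facesK flagL.
Let pureK : pure2 K := pure2_cone P_edge apexN facesK pureL.
Let subK A : A \in faces L -> A \in faces K := @sub_faces_cone _ _ _ _ facesK A.

Lemma old_edge_in_two_triangles e : e \in faces L -> #|e| = 2 ->
  exists A B, [/\ A \in faces K, B \in faces K, #|A| = 3, #|B| = 3 &
    [/\ e \subset A, e \subset B & A != B]].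
Proof.
move=> eL e2; have [A [AL eA A3]] := pureL eL.
have [be|] := boolP (boundary_edge L e).
  exists A, (apex e |: e); split; rewrite ?(cone_face facesK) ?subK //.
    exact: (card_cone P_edge apexN be).
  rewrite subsetUr; split=> //; apply: contraNneq (apexN be) => AE.
  by apply: mem_vertices AL _; rewrite AE setU11.
rewrite /boundary_edge eL e2 eqxx /= => /cards1P nb1.
have AE : A \in [set A in faces L | (#|A| == 3) && (e \subset A)].
  by rewrite inE AL A3 eqxx.
have /subsetPn[B] :
    ~~ ([set A in faces L | (#|A| == 3) && (e \subset A)] \subset [set A]).
  apply/negP=> sub; apply: nb1; exists A; apply/eqP.
  by rewrite eqEsubset sub sub1set.
rewrite inE in_set1 => /and3P[BL /eqP B3 eB] BA.
by exists A, B; rewrite !subK // eq_sym.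
Qed.

Lemma cone_unfavourable_triangle (H : graph T) : acyclic_graph H ->
  exists2 A, triangle (one_skeleton K) A &
    ~~ favourable_triangle (one_skeleton K) H A.
Proof.
move=> acyc.
have [/existsP[A /andP[]]|/existsPn allfav] :=
  boolP [exists A, triangle (one_skeleton K) A &&
           ~~ favourable_triangle (one_skeleton K) H A]; first by exists A.
have two A : A \in faces K -> #|A| = 3 ->
    #|edges (complete_on A) :&: edges H| = 2.
  move=> AK A3; have := allfav A.
  by rewrite triangleE // AK A3 favourable_triangle_flag //= negbK => /eqP.
have [C CL C3] := triL.
have [e [eC e2 eH]] := missing_edge C3 (two C (subK CL) C3).
have eL : e \in faces L by rewrite (faces_sub CL) // -card_gt0 e2.
have [A [B [AK BK A3 B3 [eA eB]]]] := old_edge_in_two_triangles eL e2.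
by rewrite (acyclic_shared_edge acyc A3 B3 e2 eA eB eH) ?two ?eqxx.
Qed.

Lemma cone_internal_favourable (HL : graph T) :
  spanning_tree (one_skeleton L) HL ->
  (forall A, triangle (one_skeleton L) A ->
     favourable_triangle (one_skeleton L) HL A) ->
  exists2 H, spanning_tree (one_skeleton K) H &
    forall A, internal (one_skeleton K) A ->
      favourable_triangle (one_skeleton K) H A.
Proof.
move=> [/andP[_ /subsetP edgesHL] treeHL vertsHL] favL.
(* The new vertices U are the apexes, and r joins each of them to some old
   neighbour; the default value of odflt is never reached on U. *)
pose U := vertices K :\: vertices L.
pose r u := odflt u [pick x in vertices L | [set u; x] \in faces K].
have rP u : u \in U -> (r u \in vertices L) && ([set u; r u] \in faces K).
  case/setDP=> uK uL; rewrite /r; case: pickP => //= none.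
  have [e be ua] := cone_new_vertex P_edge facesK uK uL.
  have [eL e2] := P_edge be.
  have /set0Pn[x xe] : e != set0 by rewrite -card_gt0 e2.
  have := none x; rewrite (mem_vertices eL xe).
  rewrite (faces_sub (cone_face facesK be)) //.
    by rewrite subUset !sub1set ua setU11 setU1r.
  by apply/set0Pn; exists u; rewrite set21.
have Ur u : u \in U -> (u \notin verts HL) && (r u \in verts HL).
  by rewrite vertsHL => uU; have /andP[-> _] := rP u uU; case/setDP: uU => _ ->.
have VH : verts (pendant Ur) = vertices K.
  rewrite /= vertsHL; apply/setP=> x; rewrite in_setU in_setD.
  by have [/(sub_vertices_cone facesK)->|] := boolP (x \in vertices L).
exists (pendant Ur).
  split=> //; last exact: pendant_tree.
  rewrite /subgraph VH subxx; apply/subsetP=> e eH.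
  have /andP[_ e2] := edges_wf eH; rewrite mem_edges e2 andbT.
  case/setUP: eH => [/edgesHL|/imsetP[u uU ->]].
    by rewrite mem_edges => /andP[/subK].
  by have /andP[] := rP u uU.
move=> A intA; have triA : triangle (one_skeleton K) A by case/and3P: intA.
have [clA A3] := andP triA.
have [clL|[e be Ae]] :=
  clique_cone P_edge apexN apex_inj facesK clA; last first.
  have AE : A = apex e |: e.
    apply/eqP; rewrite eqEcard Ae (eqP A3).
    by rewrite (card_cone P_edge apexN be).
  have /negP[] :=
    apex_triangle_not_internal P_edge apexN apex_inj facesK pureL be.
  by rewrite -AE.
have : favourable_triangle (one_skeleton L) HL A.
  by apply: favL; rewrite /triangle clL.
(* A lies in the old vertices, so no pendant edge is an edge of A. *)
rewrite !favourable_triangle_flag // => /eqP <-.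
apply/eqP; congr #|pred_of_set _|.
apply/setP=> f; rewrite !in_setI.
have [|//] /= := boolP (f \in edges (complete_on A)).
rewrite inE => /andP[fA _]; rewrite in_setU.
case: (f \in edges HL) => //=; apply/negP=> /imsetP[u uU fE].
have /andP[uL _] := Ur u uU; rewrite vertsHL in uL.
have /andP[/subsetP AV _] := clL.
by case/negP: uL; apply: AV; apply: (subsetP fA); rewrite fE set21.
Qed.

End ExtraSpecial.
End Complexes.

(** * Simple connectedness of the disk *)

From mathcomp Require Import all_order all_algebra.
From mathcomp Require Import all_classical all_reals all_analysis.
From mathcomp Require Import ring lra.
Import Order.TTheory GRing.Theory Num.Theory.
Import numFieldNormedType.Exports.
Local Open Scope classical_set_scope.
Local Open Scope ring_scope.

Section Topology.
Variable R : realType.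

Lemma within_continuous_maps (X Y Z : topologicalType) (A : set X) (B : set Y)
    (f : X -> Y) (g : Y -> Z) :
  {within A, continuous f} -> f @` A `<=` B -> {within B, continuous g} ->
  {within A, continuous (g \o f)}.
Proof.
move=> /subspace_continuousP cf fAB /subspace_continuousP cg.
apply/subspace_continuousP => x Ax.
have Bfx : B (f x) by apply: fAB; exists x.
apply: cvg_trans (cg _ Bfx).
move=> U BU.
have : nbhs x (fun z => A z -> B (f z) -> U (g (f z))) := cf x Ax _ BU.
apply: filterS => z H Az.
by apply: H => //; apply: fAB; exists z.
Qed.

Definition segment (a b : R * R) (s : R) : R * R := (1 - s) *: a + s *: b.

Lemma segment_disk a b s : unit_disk a -> unit_disk b ->
  0 <= s <= 1 -> unit_disk (segment a b s).
Proof.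
(* With c = (1 - s) a + s b, |c|^2 is the convex combination of |a|^2 and |b|^2
   minus s (1 - s) |a - b|^2. *)
case: a b => [a1 a2] [b1 b2] /= ha hb /andP[s0 s1].
change (((1 - s) * a1 + s * b1) ^+ 2 + ((1 - s) * a2 + s * b2) ^+ 2 <= 1).
have s1' : 0 <= 1 - s by rewrite subr_ge0.
have -> : ((1 - s) * a1 + s * b1) ^+ 2 + ((1 - s) * a2 + s * b2) ^+ 2 =
   (1 - s) * (a1 ^+ 2 + a2 ^+ 2) + s * (b1 ^+ 2 + b2 ^+ 2)
   - s * (1 - s) * ((a1 - b1) ^+ 2 + (a2 - b2) ^+ 2) by ring.
have := ler_wpM2l s1' ha; have := ler_wpM2l s0 hb.
have : 0 <= s * (1 - s) * ((a1 - b1) ^+ 2 + (a2 - b2) ^+ 2).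
  by rewrite !mulr_ge0 // addr_ge0 ?sqr_ge0.
rewrite /unit_disk /=; lra.
Qed.

Lemma continuous_segment (X : topologicalType) (A : set X)
    (a b : X -> R * R) (s : X -> R) :
  {within A, continuous a} -> {within A, continuous b} ->
  {within A, continuous s} ->
  {within A, continuous (fun x => segment (a x) (b x) (s x))}.
Proof.
move=> /subspace_continuousP ca /subspace_continuousP cb.
move=> /subspace_continuousP cs.
apply/subspace_continuousP => x Ax.
apply: cvgD; apply: cvgZ; [|exact: ca| exact: cs|exact:cb].
by apply: cvgB; [exact: cvg_cst|exact: cs].
Qed.

(** Paths and homotopies are straight lines in the disk, carried over to A by
    the homeomorphism f and its inverse g. *)
Lemma homeomorphic_disk_simply_connected (X : topologicalType) (A : set X) :
  homeomorphic A (@unit_disk R) -> simply_connected R A.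
Proof.
case=> f [g [cf cg fAB gBA [fK gK]]].
have fD x : A x -> unit_disk (f x) by move=> Ax; apply: fAB; exists x.
have gA y : unit_disk y -> A (g y) by move=> By; apply: gBA; exists y.
have fK' x : A x -> g (f x) = x by move=> Ax; apply: fK; rewrite inE.
split; first split.
- exists (g (0, 0)); apply: gA.
  by rewrite /unit_disk /= expr0n /= addr0 ler01.
- move=> x y Ax Ay; exists (g \o segment (f x) (f y)); split.
  + apply: (within_continuous_maps _ _ cg).
      apply: continuous_segment; apply: continuous_subspaceT => t.
      * exact: cvg_cst.
      * exact: cvg_cst.
      * exact: cvg_id.
    move=> _ [t + <-]; rewrite /= in_itv /= => t01.
    by apply: segment_disk => //; exact: fD.
  + move=> _ [t + <-]; rewrite /= in_itv /= => t01.
    by apply/gA/segment_disk => //; exact: fD.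
  + by rewrite /= /segment subr0 scale1r scale0r addr0 fK'.
  + by rewrite /= /segment subrr scale0r scale1r add0r fK'.
move=> x p Ax [cp pA p0 p1].
exists (g \o (fun st : R * R => segment (f (p st.2)) (f x) st.1)).
have pA' t : t \in `[0, 1] -> A (p t) by move=> t01; apply: pA; exists t.
have inD (st : R * R) : (`[0, 1] `*` `[0, 1])%classic st ->
    unit_disk (segment (f (p st.2)) (f x) st.1).
  move=> []; rewrite /= !in_itv /= => s01 t01.
  by apply: segment_disk => //; apply: fD => //; apply: pA'; rewrite in_itv.
split.
- apply: (within_continuous_maps _ _ cg); last by move=> _ [st /inD ? <-].
  apply: continuous_segment.
  + apply: (@within_continuous_maps (R * R)%type R _ _
      `[0, 1]%classic snd (f \o p)).
    * by apply: continuous_subspaceT => t; exact: cvg_snd.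
    * by move=> _ [[s t] [_ t01] <-].
    * exact: (within_continuous_maps cp pA cf).
  + by apply: continuous_subspaceT => t; exact: cvg_cst.
  + by apply: continuous_subspaceT => t; exact: cvg_fst.
- by move=> _ [st /inD ? <-]; exact: gA.
- move=> t t01; rewrite /= /segment subr0 scale1r scale0r addr0 fK' //.
  exact: pA'.
- by move=> t t01; rewrite /= /segment subrr scale0r scale1r add0r fK'.
- by move=> s s01; rewrite /= p0 p1 /segment -scalerDl subrK scale1r fK'.
Qed.

End Topology.

Theorem mainTheorem3 (R : realType) (T : finType) (L K : complex T)
    (K_extra_special : extra_special_from R L K)
    (L_favourable : favourable R (one_skeleton L)) :
  familyG R (one_skeleton K).
Proof.
case: K_extra_special => [[_ /built_flag_pure[flagL pureL triL]] diskK].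
case=> [apex [apexN apex_inj facesK]].
case: L_favourable => [_ [HL treeHL favL]].
have P_edge e : boundary_edge L e -> e \in faces L /\ #|e|%SET = 2%N.
  by case/and3P=> eL /eqP.
have flagK : flag K := flag_cone P_edge apexN apex_inj facesK flagL.
have scK : simply_connected_flag R (one_skeleton K).
  rewrite /simply_connected_flag /realization (faces_flag_complex flagK).
  exact: homeomorphic_disk_simply_connected.
split=> //.
  split=> // H [_ [_ acycH] _].
  exact: (cone_unfavourable_triangle flagL pureL triL apexN apex_inj facesK).
exact: (cone_internal_favourable flagL pureL apexN apex_inj facesK treeHL favL).
Qed.
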